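(* Let $m_1,\dots,m_N$ be positive real numbers, let $r_1<r_2<\cdots<r_N$ be real numbers, and let $p(x)=(x-r_1)^{m_1}\cdots(x-r_N)^{m_N}$. For $k=1,\dots,N-1$ let $x_k$ be the root of $p'$ in $(r_k,r_{k+1})$ and let $\sigma_k=\dfrac{x_k-r_k}{r_{k+1}-r_k}$. Then, for $k=1,\dots,N-1$, $$\frac{m_k}{m_k+\cdots+m_N}<\sigma_k<\frac{m_1+\cdots+m_k}{m_1+\cdots+m_{k+1}}.$$
   Context: The exponents $m_k$ are given positive real numbers, not necessarily integers. The derivative $p'$ has exactly one root $x_k$ in each interval $(r_k,r_{k+1})$, $k=1,\dots,N-1$; equivalently, $x_k$ is the unique zero of $p'/p=\sum_{j=1}^N\frac{m_j}{x-r_j}$ in that interval. The vector $(\sigma_1,\dots,\sigma_{N-1})$ is called the ratio vector of $p$.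
   Formalization: The formal theorem assumes N ≥ 3, since for N = 2 the ratio σ_1 equals m_1/(m_1+m_2), which is both bounds, so the strict inequalities fail. *)

(* Defs.v *)
From Stdlib Require Import Reals List.
From Coquelicot Require Import Coquelicot.
Open Scope R_scope.

(* Principal value of x^a for real x and a > 0: for x < 0 it is
   exp (a (ln |x| + i PI)).  In particular it is the ordinary (real) power when
   a is an integer. *)
Definition ppow (x a : R) : C :=
  if Rlt_dec 0 x then RtoC (Rpower x a)
  else if Rlt_dec x 0 then
    (Rpower (- x) a * cos (a * PI), Rpower (- x) a * sin (a * PI))
  else RtoC 0.

(* (x - r_1)^{m_1} ... (x - r_N)^{m_N}; indices start at 1, and the values of
   m and r outside 1..N are irrelevant.  The values are complex because the
   exponents need not be integers. *)
Definition polylike (N : nat) (m r : nat -> R) (x : R) : C :=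
  fold_right Cmult (RtoC 1) (map (fun j => ppow (x - r j) (m j)) (seq 1 N)).

(* x is a zero of the derivative with respect to the real variable. *)
Definition deriv_root (p : R -> C) (x : R) : Prop :=
  is_derive (K := R_AbsRing) (V := C_R_NormedModule) p x (RtoC 0).

Definition ratio (r x : nat -> R) (k : nat) : R :=
  (x k - r k) / (r (S k) - r k).

(* Main.v *)
Require Import Defs.
From Stdlib Require Import Reals Lra Lia List.
From Coquelicot Require Import Coquelicot.
Open Scope R_scope.

(** Read [p'/p = sum_j m_j / (x - r_j)] as a force: each root [r_j] repels a
    unit charge at [x] with strength [m_j / (x - r_j)], and [x_k] is the point
    of [(r_k, r_{k+1})] where the total force vanishes.

    For the upper bound, move the roots to the left of [x_k] up to [r_k], which
    strengthens their push to the right, and discard the roots beyond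
    [r_{k+1}], which all push to the left.  Neither change decreases the force
    at [x_k], and since there are at least three roots at least one of them
    increases it.  Hence the two charges [m_1 + ... + m_k] at [r_k] and
    [m_{k+1}] at [r_{k+1}] exert a positive force at [x_k], so [x_k] lies to
    the left of their point of balance, which lies the fraction
    [(m_1 + ... + m_k) / (m_1 + ... + m_{k+1})] of the way from [r_k] to
    [r_{k+1}].  The lower bound is
    the mirror image: discard the roots before [r_k] and collect those after
    [r_{k+1}] at [r_{k+1}].  Both are instances of [sum_n_m_lt], and
    [balance_ratio] converts the sign of a two-charge force into a comparison
    of ratios.

    As the exponents are real, [p] is complex valued, but only through a
    constant: between two consecutive roots the argument of each factor is
    constant, so [p] is locally a nonzero complex constant times
    [exp (sum_j m_j ln |x - r_j|)] ([polylike_local]).  So [p' = 0] does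
    amount to the vanishing of the force ([deriv_root_force]). *)

(** * Finite sums *)

(** The condition on [a] excludes [a = n = 0], where the list is empty but
    [pred 0 = 0] makes the index range [0..0]. *)
Lemma fold_right_seq_sum (f : nat -> R) (n a : nat) : (0 < a)%nat ->
  fold_right Rplus 0 (map f (seq a n)) = sum_n_m f a (pred (a + n)).
Proof.
revert a; induction n as [|n IH]; intros a Ha; simpl.
- rewrite sum_n_m_zero by lia. reflexivity.
- rewrite IH by lia.
  rewrite (sum_Sn_m f a) by lia.
  replace (pred (a + S n)) with (pred (S a + n)) by lia.
  reflexivity.
Qed.

Lemma sum_n_m_le_loc (f g : nat -> R) (a b : nat) :
  (forall j, (a <= j <= b)%nat -> f j <= g j) ->
  sum_n_m f a b <= sum_n_m g a b.
Proof.
intros H.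
destruct (Nat.lt_ge_cases b a) as [Hba|Hab].
{ rewrite !sum_n_m_zero by exact Hba. apply Rle_refl. }
induction Hab as [|b Hab IH].
- rewrite !sum_n_n. apply H. lia.
- rewrite !sum_n_Sm by lia.
  apply Rplus_le_compat; [apply IH; intros|]; apply H; lia.
Qed.

Lemma sum_n_m_lt (f g : nat -> R) (a b i : nat) :
  (a <= i <= b)%nat ->
  (forall j, (a <= j <= b)%nat -> f j <= g j) ->
  f i < g i ->
  sum_n_m f a b < sum_n_m g a b.
Proof.
intros Hi Hle Hlt.
rewrite (sum_n_m_Chasles f a i b), (sum_n_m_Chasles g a i b) by lia.
apply Rplus_lt_le_compat.
- destruct i as [|i].
  + replace a with 0%nat by lia. rewrite !sum_n_n. exact Hlt.
  + rewrite !sum_n_Sm by lia.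
    apply Rplus_le_lt_compat; [|exact Hlt].
    apply sum_n_m_le_loc. intros j Hj. apply Hle. lia.
- apply sum_n_m_le_loc. intros j Hj. apply Hle. lia.
Qed.

Lemma sum_n_m_pos (f : nat -> R) (a b : nat) : (a <= b)%nat ->
  (forall j, (a <= j <= b)%nat -> 0 < f j) -> 0 < sum_n_m f a b.
Proof.
intros Hab H.
replace 0 with (sum_n_m (fun _ => 0) a b)
  by (rewrite sum_n_m_const; apply Rmult_0_r).
apply (sum_n_m_lt _ _ a b a); [lia| |apply H; lia].
intros j Hj. apply Rlt_le, H, Hj.
Qed.

Lemma sum_n_m_scal_loc (f g : nat -> R) (c : R) (a b : nat) :
  (forall j, (a <= j <= b)%nat -> g j = f j * c) ->
  sum_n_m g a b = sum_n_m f a b * c.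
Proof.
intros H.
rewrite (sum_n_m_ext_loc g (fun j => mult (f j) c)) by exact H.
apply (sum_n_m_mult_r (K := R_Ring)).
Qed.

(** * The critical points as points of zero force *)

Definition log_modulus (m r : nat -> R) (l : list nat) (y : R) : R :=
  fold_right Rplus 0 (map (fun j => m j * ln (Rabs (y - r j))) l).

Definition force (m r : nat -> R) (l : list nat) (y : R) : R :=
  fold_right Rplus 0 (map (fun j => m j / (y - r j)) l).

Lemma is_derive_ln_Rabs (s x : R) : x <> s ->
  is_derive (fun y => ln (Rabs (y - s))) x (/ (x - s)).
Proof.
intros Hx. assert (x - s <> 0) by lra.
auto_derive.
- repeat split; auto. apply Rabs_pos_lt; auto.
- destruct (Rlt_le_dec 0 (x - s)).
  + rewrite sign_eq_1, Rabs_pos_eq by lra. field. lra.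
  + rewrite sign_eq_m1, Rabs_left by lra. field. lra.
Qed.

Lemma is_derive_log_modulus (m r : nat -> R) (l : list nat) (x : R) :
  (forall j, In j l -> x <> r j) ->
  is_derive (log_modulus m r l) x (force m r l x).
Proof.
induction l as [|j l IH]; intros H.
- apply (is_derive_const (K := R_AbsRing) (V := R_NormedModule) 0 x).
- apply (is_derive_plus (K := R_AbsRing) (V := R_NormedModule)
           (fun y => m j * ln (Rabs (y - r j))) (log_modulus m r l)).
  + apply (is_derive_scal (fun y => ln (Rabs (y - r j)))).
    apply is_derive_ln_Rabs. apply H. now left.
  + apply IH. intros i Hi. apply H. now right.
Qed.

(** The phase is [1] to the right of [s] and [exp (i a PI)] to the left. *)
Lemma ppow_local (s a x : R) : x <> s ->
  exists c : C, c <> RtoC 0 /\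
    locally x (fun y =>
      ppow (y - s) a = Cmult c (RtoC (exp (a * ln (Rabs (y - s)))))).
Proof.
intros Hx. destruct (Rlt_le_dec s x) as [Hs|Hs].
- exists (RtoC 1). split.
  + intros E. apply (f_equal fst) in E. simpl in E. lra.
  + apply (filter_imp (fun y => s < y)); [|apply (open_gt s x Hs)].
    intros y Hy. unfold ppow.
    destruct (Rlt_dec 0 (y - s)); [|lra].
    rewrite Rabs_pos_eq, Cmult_1_l by lra. reflexivity.
- assert (Hs' : x < s) by lra.
  exists (cos (a * PI), sin (a * PI)). split.
  + intros E. injection E as Ec Es.
    pose proof (sin2_cos2 (a * PI)) as H.
    rewrite Ec, Es in H. unfold Rsqr in H. lra.
  + apply (filter_imp (fun y => y < s)); [|apply (open_lt s x Hs')].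
    intros y Hy. unfold ppow.
    destruct (Rlt_dec 0 (y - s)); [lra|].
    destruct (Rlt_dec (y - s) 0); [|lra].
    rewrite Rabs_left by lra. unfold Rpower, Cmult, RtoC; simpl.
    f_equal; ring.
Qed.

(** Away from the roots the phases multiply to a constant and the moduli to an
    exponential, so that differentiating a complex-valued product reduces to
    differentiating a real sum of logarithms. *)
Lemma polylike_local (m r : nat -> R) (l : list nat) (x : R) :
  (forall j, In j l -> x <> r j) ->
  exists c : C, c <> RtoC 0 /\
    locally x (fun y =>
      fold_right Cmult (RtoC 1) (map (fun j => ppow (y - r j) (m j)) l)
      = Cmult c (RtoC (exp (log_modulus m r l y)))).
Proof.
induction l as [|j l IH]; intros H.
- exists (RtoC 1). split.
  + intros E. apply (f_equal fst) in E. simpl in E. lra.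
  + apply filter_forall. intros y. unfold log_modulus; simpl.
    rewrite exp_0, Cmult_1_l. reflexivity.
- destruct IH as [c [Hc Hl]]; [intros i Hi; apply H; now right|].
  destruct (ppow_local (r j) (m j) x) as [d [Hd Hj]]; [apply H; now left|].
  exists (Cmult d c). split; [now apply Cmult_neq_0|].
  generalize (filter_and _ _ Hl Hj). apply filter_imp.
  intros y [El Ej]. unfold log_modulus in *; simpl.
  rewrite El, Ej, exp_plus, RtoC_mult. ring.
Qed.

Lemma is_derive_fst (f : R -> C) (x : R) (l : C) :
  is_derive (K := R_AbsRing) (V := C_R_NormedModule) f x l ->
  is_derive (fun y => fst (f y)) x (fst l).
Proof.
intros H.
apply (filterdiff_comp f (fun z : C => fst z) _ (fun z : C => fst z) H).
apply filterdiff_linear.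
apply (is_linear_fst (K := R_AbsRing) (U := R_NormedModule)
         (V := R_NormedModule)).
Qed.

Lemma is_derive_snd (f : R -> C) (x : R) (l : C) :
  is_derive (K := R_AbsRing) (V := C_R_NormedModule) f x l ->
  is_derive (fun y => snd (f y)) x (snd l).
Proof.
intros H.
apply (filterdiff_comp f (fun z : C => snd z) _ (fun z : C => snd z) H).
apply filterdiff_linear.
apply (is_linear_snd (K := R_AbsRing) (U := R_NormedModule)
         (V := R_NormedModule)).
Qed.

(** One of the two real components of the constant phase is nonzero; the
    corresponding component of [p] is a nonzero multiple of [exp] of the log
    modulus, and [exp] has no critical value. *)
Lemma deriv_root_force (N : nat) (m r : nat -> R) (x : R) :
  (forall j, (1 <= j <= N)%nat -> x <> r j) ->
  deriv_root (polylike N m r) x ->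
  sum_n_m (fun j => m j / (x - r j)) 1 N = 0.
Proof.
intros Hx Hp.
assert (Hin : forall j, In j (seq 1 N) -> x <> r j).
{ intros j Hj. apply in_seq in Hj. apply Hx. lia. }
destruct (polylike_local m r (seq 1 N) x Hin) as [c [Hc Hloc]].
set (L := log_modulus m r (seq 1 N)) in Hloc.
assert (HL : is_derive L x (force m r (seq 1 N) x))
  by now apply is_derive_log_modulus.
assert (Hcomp : forall (u : R -> R) (a : R), is_derive u x 0 ->
    locally x (fun y => u y = a * exp (L y)) ->
    a * (exp (L x) * force m r (seq 1 N) x) = 0).
{ intros u a Hu Hloc'.
  apply is_derive_unique in Hu. rewrite <- Hu.
  rewrite (Derive_ext_loc _ _ _ Hloc'). symmetry.
  apply is_derive_unique, is_derive_scal.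
  rewrite Rmult_comm.
  apply (is_derive_comp (K := R_AbsRing) (V := R_NormedModule) exp L x);
    [apply is_derive_exp | exact HL]. }
assert (H1 := Hcomp _ (fst c) (is_derive_fst _ _ _ Hp)).
assert (H2 := Hcomp _ (snd c) (is_derive_snd _ _ _ Hp)).
transitivity (force m r (seq 1 N) x).
{ symmetry. apply (fold_right_seq_sum (fun j => m j / (x - r j)) N 1). lia. }
assert (He := exp_pos (L x)).
destruct (Req_dec (force m r (seq 1 N) x) 0) as [F|F]; [exact F|exfalso].
assert (HeF : exp (L x) * force m r (seq 1 N) x <> 0)
  by (apply Rmult_integral_contrapositive_currified; lra).
apply Hc. destruct c as [a b]. unfold RtoC. f_equal.
- destruct (Rmult_integral a _ (H1 ltac:(
    revert Hloc; apply filter_imp; intros y E;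
    unfold polylike; rewrite E; simpl; ring))); tauto.
- destruct (Rmult_integral b _ (H2 ltac:(
    revert Hloc; apply filter_imp; intros y E;
    unfold polylike; rewrite E; simpl; ring))); tauto.
Qed.

(** * Comparison with two charges *)

(** A point at distances [u] and [v] from charges [a] on its left and [b] on
    its right: the force on it and its deviation from the point of balance
    differ by a positive factor. *)
Lemma balance_ratio (a b u v : R) : 0 < a -> 0 < b -> 0 < u -> 0 < v ->
  exists w, 0 < w /\ a / (a + b) - u / (u + v) = (a / u - b / v) * w.
Proof.
intros. exists (u * v / ((a + b) * (u + v))). split.
- apply Rdiv_lt_0_compat; apply Rmult_lt_0_compat; lra.
- field. repeat split; lra.
Qed.

Lemma increasing_on_range (r : nat -> R) (N : nat) :
  (forall k, (1 <= k < N)%nat -> r k < r (S k)) ->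
  forall i j, (1 <= i)%nat -> (i <= j <= N)%nat -> r i <= r j.
Proof.
intros Hr i j Hi [Hij Hj]. induction Hij as [|j Hij IH]; [lra|].
assert (r i <= r j) by (apply IH; lia).
assert (r j < r (S j)) by (apply Hr; lia). lra.
Qed.

Theorem theorem3 (N : nat) (m r x : nat -> R)
  (HN : (3 <= N)%nat)
  (Hm : forall k : nat, (1 <= k <= N)%nat -> 0 < m k)
  (Hr : forall k : nat, (1 <= k < N)%nat -> r k < r (S k))
  (Hx : forall k : nat, (1 <= k < N)%nat ->
     r k < x k < r (S k) /\ deriv_root (polylike N m r) (x k)) :
  forall k : nat, (1 <= k < N)%nat ->
    m k / sum_n_m m k N < ratio r x k
      < sum_n_m m 1 k / sum_n_m m 1 (S k).
Proof.
intros k Hk.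
destruct (Hx k Hk) as [[Hlo Hhi] Hroot].
set (X := x k) in *. set (u := X - r k). set (v := r (S k) - X).
assert (Hu : 0 < u) by (unfold u; lra).
assert (Hv : 0 < v) by (unfold v; lra).
assert (Hle : forall j, (1 <= j <= k)%nat -> u <= X - r j).
{ intros j Hj. assert (r j <= r k)
    by (apply (increasing_on_range r N Hr); lia). unfold u; lra. }
assert (Hge : forall j, (S k <= j <= N)%nat -> v <= r j - X).
{ intros j Hj. assert (r (S k) <= r j)
    by (apply (increasing_on_range r N Hr); lia). unfold v; lra. }
assert (H0 : sum_n_m (fun j => m j / (X - r j)) 1 N = 0).
{ apply deriv_root_force; [|exact Hroot].
  intros j Hj E. destruct (Nat.le_gt_cases j k).
  - assert (u <= X - r j) by (apply Hle; lia). lra.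
  - assert (v <= r j - X) by (apply Hge; lia). lra. }
(* The index of a charge that is neither [k] nor [k+1]: moving or discarding
   it is what makes the inequalities strict. *)
assert (Hi : exists i, (1 <= i < k \/ S k < i <= N)%nat).
{ destruct (Nat.eq_dec k 1); [exists 3%nat | exists 1%nat]; lia. }
destruct Hi as [i Hi].
assert (Hi1N : (1 <= i <= N)%nat) by lia.
assert (Fleft : forall j, (1 <= j < k)%nat ->
  0 < m j / (X - r j) < m j * / u).
{ intros j Hj. assert (0 < m j) by (apply Hm; lia).
  assert (u < X - r j).
  { assert (u <= X - r (S j)) by (apply Hle; lia).
    assert (r j < r (S j)) by (apply Hr; lia). lra. }
  split; [apply Rdiv_lt_0_compat; lra|].
  apply Rmult_lt_compat_l; [lra|].
  apply Rinv_lt_contravar; [apply Rmult_lt_0_compat|]; lra. }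
assert (Fright : forall j, (S k < j <= N)%nat ->
  m j * - / v < m j / (X - r j) < 0).
{ intros j Hj. assert (0 < m j) by (apply Hm; lia).
  assert (v < r j - X).
  { destruct j as [|j]; [lia|].
    assert (v <= r j - X) by (apply Hge; lia).
    assert (r j < r (S j)) by (apply Hr; lia). lra. }
  replace (m j / (X - r j)) with (m j * - / (r j - X)) by (field; lra).
  assert (0 < / (r j - X)) by (apply Rinv_0_lt_compat; lra).
  assert (/ (r j - X) < / v)
    by (apply Rinv_lt_contravar; [apply Rmult_lt_0_compat|]; lra).
  split.
  - apply Rmult_lt_compat_l; lra.
  - assert (0 < m j * / (r j - X)) by (apply Rmult_lt_0_compat; lra). lra. }
assert (Fk : m k / (X - r k) = m k * / u) by reflexivity.
assert (FSk : m (S k) / (X - r (S k)) = m (S k) * - / v)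
  by (unfold v; field; lra).
assert (Hmk : 0 < m k) by (apply Hm; lia).
assert (HmSk : 0 < m (S k)) by (apply Hm; lia).
assert (Hratio : ratio r x k = u / (u + v)).
{ unfold ratio, u, v. fold X. f_equal. lra. }
rewrite Hratio. clear Hratio. split.
- (* Nothing before [k]; everything after [k] collected at [r (S k)]. *)
  set (g := fun j => if Nat.ltb j k then 0
                     else if Nat.eqb j k then m j * / u else m j * - / v).
  assert (Hg : sum_n_m g 1 N < 0).
  { rewrite <- H0. apply (sum_n_m_lt _ _ 1 N i Hi1N).
    - intros j Hj. unfold g.
      destruct (Nat.ltb_spec j k); [apply Rlt_le, Fleft; lia|].
      destruct (Nat.eqb_spec j k); [subst j; lra|].
      destruct (Nat.eq_dec j (S k)); [subst j; lra|].
      apply Rlt_le, Fright; lia.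
    - unfold g. destruct (Nat.ltb_spec i k); [apply Fleft; lia|].
      destruct (Nat.eqb_spec i k); [lia|]. apply Fright; lia. }
  set (B := sum_n_m m (S k) N).
  assert (HB : 0 < B) by (apply sum_n_m_pos; [lia|]; intros; apply Hm; lia).
  assert (Eg : sum_n_m g 1 N = m k / u - B / v).
  { destruct k as [|k']; [lia|].
    rewrite (sum_n_m_Chasles g 1 k' N), (sum_Sn_m g (S k')) by lia.
    rewrite (sum_n_m_scal_loc m g 0 1 k'), (sum_n_m_scal_loc m g (- / v)).
    - replace (g (S k')) with (m (S k') * / u).
      + unfold B, plus; simpl. unfold Rdiv. ring.
      + unfold g. rewrite Nat.ltb_irrefl, Nat.eqb_refl. reflexivity.
    - intros j Hj. unfold g.
      destruct (Nat.ltb_spec j (S k')); [lia|].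
      destruct (Nat.eqb_spec j (S k')); [lia|reflexivity].
    - intros j Hj. unfold g.
      destruct (Nat.ltb_spec j (S k')); [ring|lia]. }
  replace (sum_n_m m k N) with (m k + B)
    by (unfold B; rewrite (sum_Sn_m m k) by lia; reflexivity).
  destruct (balance_ratio (m k) B u v) as [w [Hw E]]; auto.
  rewrite <- Eg in E.
  assert (0 < (- sum_n_m g 1 N) * w) by (apply Rmult_lt_0_compat; lra).
  lra.
- (* Everything up to [k] collected at [r k]; nothing after [S k]. *)
  set (g := fun j => if Nat.leb j k then m j * / u
                     else if Nat.eqb j (S k) then m j * - / v else 0).
  assert (Hg : 0 < sum_n_m g 1 N).
  { rewrite <- H0. apply (sum_n_m_lt _ _ 1 N i Hi1N).
    - intros j Hj. unfold g.
      destruct (Nat.leb_spec j k).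
      + destruct (Nat.eq_dec j k); [subst j; lra|].
        apply Rlt_le, Fleft; lia.
      + destruct (Nat.eqb_spec j (S k)); [subst j; lra|].
        apply Rlt_le, Fright; lia.
    - unfold g. destruct (Nat.leb_spec i k); [apply Fleft; lia|].
      destruct (Nat.eqb_spec i (S k)); [lia|]. apply Fright; lia. }
  set (A := sum_n_m m 1 k).
  assert (HA : 0 < A) by (apply sum_n_m_pos; [lia|]; intros; apply Hm; lia).
  assert (Eg : sum_n_m g 1 N = A / u - m (S k) / v).
  { rewrite (sum_n_m_Chasles g 1 k N), (sum_Sn_m g (S k)) by lia.
    rewrite (sum_n_m_scal_loc m g (/ u) 1 k), (sum_n_m_scal_loc m g 0).
    - replace (g (S k)) with (m (S k) * - / v).
      + unfold A, plus; simpl. unfold Rdiv. ring.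
      + unfold g. destruct (Nat.leb_spec (S k) k); [lia|].
        rewrite Nat.eqb_refl. reflexivity.
    - intros j Hj. unfold g.
      destruct (Nat.leb_spec j k); [lia|].
      destruct (Nat.eqb_spec j (S k)); [lia|ring].
    - intros j Hj. unfold g.
      destruct (Nat.leb_spec j k); [reflexivity|lia]. }
  replace (sum_n_m m 1 (S k)) with (A + m (S k))
    by (unfold A; rewrite (sum_n_Sm m 1 k) by lia; reflexivity).
  destruct (balance_ratio A (m (S k)) u v) as [w [Hw E]]; auto.
  rewrite <- Eg in E.
  assert (0 < sum_n_m g 1 N * w) by (apply Rmult_lt_0_compat; lra).
  lra.
Qed.
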